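(* Let $\mathcal{S}\in\mathbb{M}$ be a background model with $0\in\mathcal{S}_{\mathrm{acc}}$, and let $\mathcal{M}=\langle\mathcal{M}_{\mathrm{acc}};\mathcal{M}_{\mathrm{rej}}\rangle$ be an assessment on $\mathcal{L}$. Then $\mathcal{M}$ is a model without confusion that dominates $\mathcal{S}$ (i.e., $\mathcal{M}\in\mathbb{M}_{\mathcal{S}}$) if and only if all of the following hold: (AR1) $\mathcal{S}\subseteq\mathcal{M}$; (AR2) $0\notin\mathcal{M}_{\mathrm{rej}}$; (AR3) $\mathcal{M}_{\mathrm{acc}}$ is a cone; (AR4) $\overline{\mathcal{M}_{\mathrm{rej}}}-\mathcal{M}_{\mathrm{acc}}\subseteq\mathcal{M}_{\mathrm{rej}}$.
   Context: Let $\Omega$ be a non-empty set and let $\mathcal{L}$ be a real linear subspace of the vector space of all real-valued functions (''gambles'') on $\Omega$ with pointwise operations. For $\mathcal{K},\mathcal{K}'\subseteq\mathcal{L}$: $\mathcal{K}-\mathcal{K}'=\{f-g:f\in\mathcal{K},g\in\mathcal{K}'\}$ (empty if either set is empty); $\overline{\mathcal{K}}=\{\lambda f:\lambda>0,f\in\mathcal{K}\}$; $\operatorname{posi}\mathcal{K}$ is the set of all linear combinations with strictly positive coefficients of non-empty finite families of elements of $\mathcal{K}$ (so $\operatorname{posi}\emptyset=\emptyset$). A cone is a set $\mathcal{K}\subseteq\mathcal{L}$ with $\operatorname{posi}\mathcal{K}=\mathcal{K}$. An assessment is a pair $\mathcal{A}=\langle\mathcal{A}_{\mathrm{acc}};\mathcal{A}_{\mathrm{rej}}\rangle$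 of subsets of $\mathcal{L}$ (accepted and rejected gambles). Inclusion of assessments is component-wise. A model without confusion is an assessment $\mathcal{M}$ such that $\mathcal{M}_{\mathrm{acc}}\cap\mathcal{M}_{\mathrm{rej}}=\emptyset$, $\mathcal{M}_{\mathrm{acc}}$ is a cone, and $\overline{\mathcal{M}_{\mathrm{rej}}}\cup(\overline{\mathcal{M}_{\mathrm{rej}}}-\mathcal{M}_{\mathrm{acc}})\subseteq\mathcal{M}_{\mathrm{rej}}$. The set of these is $\mathbb{M}$, and $\mathbb{M}_{\mathcal{S}}=\{\mathcal{M}\in\mathbb{M}:\mathcal{S}\subseteq\mathcal{M}\}$. *)

(* Defs.v *)
From mathcomp Require Import all_boot all_order all_algebra.
From mathcomp Require Import all_classical all_reals.

Set Implicit Arguments.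
Unset Strict Implicit.
Unset Printing Implicit Defensive.

Import Order.TTheory GRing.Theory Num.Theory.
Local Open Scope classical_set_scope.
Local Open Scope ring_scope.

(* R^o is R as a module over itself, which makes gambles a module over R. *)
Definition gamble (R : realType) (Omega : Type) : lmodType R :=
  (Omega -> R^o)%type.

Section Gambles.
Context {R : realType} {Omega : Type}.
Local Notation gambles := (set (gamble R Omega)).
Implicit Types K L : gambles.

Definition linear_subspace L := GRing.submod_closed [in L].

Definition set_sub K K' : gambles := [set f - g | f in K & g in K'].

Definition pos_scalings K : gambles :=
  [set h | exists lam : R, exists f, [/\ 0 < lam, K f & h = lam *: f]].

Definition posi K : gambles :=
  [set h | exists n (lam : 'I_n.+1 -> R) (f : 'I_n.+1 -> gamble R Omega),
    (forall i, 0 < lam i /\ K (f i)) /\ h = \sum_i lam i *: f i].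

Definition cone K := posi K = K.

Record assessment L := Assessment {
  acc : gambles;
  rej : gambles;
  acc_sub : acc `<=` L;
  rej_sub : rej `<=` L }.

Definition assessment_le L (A B : assessment L) :=
  acc A `<=` acc B /\ rej A `<=` rej B.

Definition models_without_confusion L : set (assessment L) :=
  [set M | [/\ acc M `&` rej M = set0,
    cone (acc M) &
    pos_scalings (rej M) `|` set_sub (pos_scalings (rej M)) (acc M)
      `<=` rej M]].

Definition models_dominating L (S : assessment L) : set (assessment L) :=
  [set M | models_without_confusion M /\ assessment_le S M].

End Gambles.

(* Main.v *)
Require Import Defs.
From mathcomp Require Import all_boot all_order all_algebra.
From mathcomp Require Import all_classical all_reals.

Import Order.TTheory GRing.Theory Num.Theory.
Local Open Scope classical_set_scope.
Local Open Scope ring_scope.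

(** The background model puts the zero gamble [0] in [acc M] as soon as [M]
    dominates it. Hence disjointness of [acc M] and [rej M] keeps [0] out of
    [rej M]; conversely, a gamble [f] both accepted and rejected would make
    [0 = f - f] rejected. Closure of [rej M] under positive scaling is the
    instance [h = h - 0] of closure under subtraction of accepted gambles. *)

Theorem theorem2p21 (R : realType) (Omega : Type)
    (Omega_neq0 : [set: Omega] !=set0)
    (L : set (gamble R Omega)) (linL : linear_subspace L)
    (S : assessment L) (S_model : models_without_confusion S)
    (S_acc0 : acc S 0) (M : assessment L) :
  models_dominating S M <->
  [/\ assessment_le S M,
      ~ rej M 0,
      cone (acc M) &
      set_sub (pos_scalings (rej M)) (acc M) `<=` rej M].
Proof.
have Macc0 : assessment_le S M -> acc M 0 by case=> Sacc _; exact: Sacc.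
split=> [[[disj coneM closed] SM]|[SM rej0 coneM closed]].
  split=> //; last by move=> h hM; apply: closed; right.
  by move=> rej0; rewrite -[False]/(set0 (0 : gamble R Omega)) -disj; split=> //; exact: Macc0.
split=> //; split=> //.
  rewrite -subset0 => f [accf rejf]; apply: rej0; apply: closed.
  exists f; last by exists f => //; exact: subrr.
  by exists 1, f; split=> //; rewrite scale1r.
move=> h [hM|]; last exact: closed.
by apply: closed; exists h => //; exists 0; [exact: Macc0|rewrite subr0].
Qed.
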